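(* Let $G=(V\cup\{s\},E)$ be a finite, unoriented, connected, loop-free graph (multiple edges allowed) with distinguished sink vertex $s$, and let $e$ be an edge of $E$ which is neither a bridge (i.e. removing $e$ does not disconnect the graph) nor incident to the sink. Then \[L_G(x)=x\,L_{G\setminus e}(x)+L_{G.e}(x).\]
   Context: Graphs considered: finite, unoriented, connected, loop-free graphs $G=(V\cup\{s\},E)$, possibly with multiple edges, with a distinguished vertex $s$ called the sink. A configuration is $\eta=(\eta_v)_{v\in V}\in\mathbb{Z}_+^{|V|}$; it is stable if $\eta_v\le d^G(v)$ for all $v\in V$, where $d^G(v)$ is the degree of $v$ in $G$. In the stochastic sandpile model with parameter $p\in(0,1)$, grains are added at random vertices (with a distribution whose support is all of $V$), and an unstable vertex $x$ (with $\eta_x>d^G(x)$) topples by sending, independently along each incident edge, one grain to the neighbour with probability $p$ (grains sent to $s$ are lost); topplings continue until the configuration is stable. The stochastically recurrent configurations ${\sf Sto}(G)$ are the recurrent states of the resulting Markov chain on stable configurations (the recurrent class containing the maximal configuration $(d^G(v))_{v\in V}$). Equivalently, a stable $\eta$ is stochastically recurrent iff there is an orientation $O$ of the edges of $G$ such that for every $v\in V$, the number of edges oriented into $v$ is at least $1+d^G(v)-\eta_v$. The lacking polynomial is $L_G(x)=\sum_{\eta\in{\sf Sto}(G)}x^{\sum_{v\in V}(d^G(v)-\eta_v)}$. For an edge $e=\{x,y\}$ with $x,y\neq s$: $G\setminus e$ is $G$ with (one copy of) $e$ removed. $G.e$ is defined as follows: if $e$ is a simple edge, $G.e$ is $G$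 with $e$ contracted, i.e. $x$ and $y$ are replaced by a single vertex $x.y$ and all edges incident in $G$ to $x$ or $y$ (other than $e$) are now incident to $x.y$; if $e$ has multiplicity $k\ge 2$, one copy of $e$ is contracted in this way and the other $k-1$ copies are replaced by $k-1$ edges $\{x.y,s\}$ joining the merged vertex to the sink. *)

(* Defs.v *)
From HB Require Import structures.
From mathcomp Require Import all_boot all_order all_algebra.
From mathcomp Require Import all_classical all_reals all_analysis.

Set Implicit Arguments.
Unset Strict Implicit.
Unset Printing Implicit Defensive.

Import Order.TTheory GRing.Theory Num.Theory.
Import numFieldNormedType.Exports.

Local Open Scope ring_scope.
Local Open Scope classical_set_scope.

(* Finite unoriented loop-free multigraphs with a sink. The vertex set is
   [option (vertex G)], where [None] is the sink. Edges are labelled, so that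
   parallel edges are distinct labels with the same pair of ends. *)
Record sink_graph := SinkGraph {
  vertex : finType;
  edge : finType;
  ends : edge -> {set option vertex};
  card_ends : forall f, #|ends f| = 2 }.

Section Graph.
Variable G : sink_graph.

Definition adjacent : rel (option (vertex G)) :=
  [rel u v | [exists f : edge G, ends f == [set u; v]%SET]].

Definition graph_connected : bool := [forall u, forall v, connect adjacent u v].

Definition incident (v : vertex G) : {set edge G} :=
  [set f : edge G | Some v \in ends f]%SET.

Definition degree (v : vertex G) : nat := #|incident v|.

End Graph.

Section DeletionContraction.
Variables (G : sink_graph) (e : edge G).

Definition delete_edge : sink_graph :=
  @SinkGraph (vertex G) {f : edge G | f != e} (fun f => ends (val f))
    (fun f => card_ends (val f)).

Definition bridge : bool := ~~ graph_connected delete_edge.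

(* The vertices of G.e: those of G that are not ends of e, and the merged
   vertex x.y, which is [inr tt]. *)
Definition contract_vertex : finType :=
  ({v : vertex G | Some v \notin ends e} + unit)%type.

Definition merge_vertex (u : option (vertex G)) : option contract_vertex :=
  omap (fun v : vertex G =>
    if insub v is Some w then inl w else inr tt) u.

(* The other edges parallel to e, if any, are redirected to the sink. *)
Definition contract_ends (f : {f : edge G | f != e}) :
    {set option contract_vertex} :=
  if ends (val f) == ends e then [set Some (inr tt); None]%SET
  else (merge_vertex @: ends (val f))%SET.

Lemma card_contract_ends f : #|contract_ends f| = 2.
Proof.
rewrite /contract_ends; case: ifPn => [_|ne_fe]; first by rewrite cards2.
rewrite -(card_ends (val f)); apply: card_in_imset => u v uf vf muv.
apply/eqP; apply: contraNT ne_fe => ne_uv.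
have endsE (g : edge G) : u \in ends g -> v \in ends g ->
    ends g = [set u; v]%SET.
  move=> ug vg; apply/esym/eqP; rewrite eqEcard cards2 ne_uv card_ends andbT.
  by apply/fintype.subsetP => w; rewrite !inE => /orP[] /eqP->.
suff [ue ve] : u \in ends e /\ v \in ends e.
  by rewrite (endsE _ uf vf) (endsE _ ue ve).
case: u v {uf vf endsE} muv ne_uv => [u|] [v|] //=.
case: insubP => [a _ au|]; case: insubP => [b _ bv|] //.
  by case=> eq_ab; rewrite -au -bv eq_ab eqxx.
by rewrite !negbK.
Qed.

Definition contract_edge : sink_graph := SinkGraph card_contract_ends.

End DeletionContraction.

Section Configurations.
Variable G : sink_graph.

Definition config := {ffun vertex G -> nat}.

Definition stable (c : config) : bool := [forall v, c v <= degree v]%N.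

Definition stable_config := {dffun forall v : vertex G, 'I_(degree v).+1}.

Definition to_config (c : stable_config) : config := [ffun v => c v : nat].

Definition add_grain (c : config) (v : vertex G) : config :=
  [ffun w => c w + (w == v)]%N.

(* x sends one grain along each edge of A, a set of edges incident to x. *)
Definition topple (c : config) (x : vertex G) (A : {set edge G}) : config :=
  [ffun v => if v == x then (c v - #|A|)%N
             else (c v + #|A :&: incident v|)%N].

Definition lacking (c : stable_config) : nat :=
  (\sum_(v : vertex G) (degree v - c v))%N.

End Configurations.

(* The parameters of the stochastic sandpile model. The unstable vertex that
   topples next is chosen by an arbitrary rule. *)
Record sandpile (R : realType) (G : sink_graph) := Sandpile {
  topple_prob : R;
  grain_law : vertex G -> R;
  topple_rule : config G -> vertex G;
  topple_prob_gt0 : 0 < topple_prob;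
  topple_prob_lt1 : topple_prob < 1;
  grain_law_gt0 : forall v, 0 < grain_law v;
  grain_law_sum1 : \sum_v grain_law v = 1;
  topple_ruleP : forall c, ~~ stable c ->
    (degree (topple_rule c) < c (topple_rule c))%N }.

Section StochasticSandpile.
Variables (R : realType) (G : sink_graph) (M : sandpile R G).

(* Probability that, in a toppling of x, the set of edges along which a grain
   is sent is A. *)
Definition topple_weight (x : vertex G) (A : {set edge G}) : R :=
  topple_prob M ^+ #|A| * (1 - topple_prob M) ^+ (degree x - #|A|).

(* Probability that c is stabilised into d by at most n topplings. *)
Fixpoint stabilize_within (n : nat) (c : config G) (d : stable_config G) : R :=
  if stable c then (c == to_config d)%:R
  else if n is m.+1 then
    let x := topple_rule M c in
    \sum_(A : {set edge G} | A \subset incident x)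
      topple_weight x A * stabilize_within m (topple c x A) d
  else 0.

Definition stabilize_prob (c : config G) (d : stable_config G) : R :=
  limn (fun n => stabilize_within n c d).

Definition transition (c d : stable_config G) : R :=
  \sum_v grain_law M v * stabilize_prob (add_grain (to_config c) v) d.

(* Probability that the chain started at c visits d, at a positive time, for
   the first time at time n.+1. *)
Fixpoint first_visit (n : nat) (c d : stable_config G) : R :=
  if n is m.+1 then \sum_(b | b != d) transition c b * first_visit m b d
  else transition c d.

(* The chain started at c returns to c with probability 1. *)
Definition recurrent (c : stable_config G) : Prop :=
  series (fun n => first_visit n c c) @ \oo --> (1 : R).

Definition Sto : {set stable_config G} :=
  [set c : stable_config G | `[< recurrent c >]]%SET.

Definition lacking_poly : {poly int} := \sum_(c in Sto) 'X^(lacking c).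

End StochasticSandpile.

(* Main.v *)
Require Import Defs.
From mathcomp Require Import all_classical all_reals all_analysis.
From mathcomp Require Import all_boot all_order all_algebra.
From mathcomp Require Import zify ring.

(** Recurrence is first made combinatorial. Say that c is good if some
    orientation gives every vertex v fewer than c v outgoing edges. Topplings
    preserve goodness: after x topples, orient into x the edges that received a
    grain and away from x the others. The maximal configuration is good, so
    recurrent configurations are good. Conversely, undoing topplings from a
    good configuration adds as many grains as one likes at every vertex, so it
    is reached from every configuration and is recurrent.

    The deletion-contraction identity is then about the sets of vectors l
    (of lacking grains) with l + 1 below the indegrees of some orientation.
    Let x and y be the ends of e. Fixing l off x and y and the sum l x + l y,
    the vectors of G form an interval, by the exchange property of indegrees.
    If it is nonempty, its element with the largest l x accounts for the one
    vector of G.e, and decreasing the y-coordinate of the others by 1 gives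
    the vectors of G \ e. *)

Set Implicit Arguments.
Unset Strict Implicit.
Unset Printing Implicit Defensive.

Import Order.TTheory GRing.Theory Num.Theory.
Import numFieldNormedType.Exports.

Local Open Scope nat_scope.
Local Open Scope set_scope.

(** [lev] is the distance to [t]: the first step of a shortest path lowers it. *)
Lemma connect_level (T : finType) (r : rel T) (t : T) :
  (forall x, connect r x t) ->
  exists lev : T -> nat,
    forall x, x != t -> exists2 y, r x y & lev y < lev x.
Proof.
move=> conn.
pose P x n := [exists p : n.-tuple T, path r x p && (last x p == t)].
have exP x : exists n, P x n.
  have /connectP[p rp tE] := conn x.
  by exists (size p); apply/existsP; exists (in_tuple p); rewrite rp -tE eqxx.
exists (fun x => ex_minn (exP x)) => x nxt.
case: ex_minnP => -[|n] /existsP[p /andP[rp /eqP lp]] _.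
  by rewrite tuple0 in lp; rewrite /= in lp; rewrite lp eqxx in nxt.
move: rp lp; rewrite (tuple_eta p) /= => /andP[rxy rp] lp.
exists (thead p) => //; case: ex_minnP => m _; rewrite ltnS; apply.
by apply/existsP; exists (behead_tuple p); rewrite rp lp eqxx.
Qed.

(** * Legal topplings and the abelian property *)

Section Legal.
Variable G : sink_graph.
Implicit Types (c d g : config G) (x v z : vertex G) (A B : {set edge G}).

(** The receiving edges [A] are chosen freely: every choice has positive probability in the
    model. *)
Inductive legal : nat -> config G -> config G -> Prop :=
| Legal0 c : legal 0 c c
| LegalS n x A c d : degree x < c x -> A \subset incident x ->
    legal n (topple c x A) d -> legal n.+1 c d.

Definition add_config c d : config G := [ffun v => c v + d v].

Lemma stablePn c : reflect (exists x, degree x < c x) (~~ stable c).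
Proof.
rewrite /stable negb_forall.
by apply: (iffP existsP) => -[x H]; exists x; rewrite ?ltnNge // -ltnNge.
Qed.

Lemma card_sub_incident A x c :
  A \subset incident x -> degree x < c x -> #|A| < c x.
Proof. by move=> sA; apply: leq_ltn_trans; apply: subset_leq_card. Qed.

Lemma toppleC c x z A B : z != x ->
  A \subset incident x -> degree x < c x ->
  B \subset incident z -> degree z < c z ->
  topple (topple c z B) x A = topple (topple c x A) z B.
Proof.
move=> zx sA cx sB cz; apply/ffunP => v; rewrite !ffunE.
have := card_sub_incident sA cx; have := card_sub_incident sB cz.
have [->|vx] := eqVneq v x; first by rewrite eq_sym (negPf zx) /=; lia.
by have [->|vz] := eqVneq v z; lia.
Qed.

Lemma topple_add c d x A : A \subset incident x -> degree x < c x ->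
  topple (add_config c d) x A = add_config (topple c x A) d.
Proof.
move=> sA cx; apply/ffunP => v; rewrite !ffunE.
have ltA := card_sub_incident sA cx.
by case: eqVneq => [->|_]; lia.
Qed.

Lemma topple_total c x A : A \subset incident x -> degree x < c x ->
  \sum_v topple c x A v <= \sum_v c v.
Proof.
move=> sA cx; rewrite (bigD1 x) //= [X in _ <= X](bigD1 x) //= ffunE eqxx.
have -> : \sum_(v | v != x) topple c x A v =
    \sum_(v | v != x) c v + \sum_(v | v != x) #|A :&: incident v|.
  by rewrite -big_split; apply: eq_bigr => v /negPf vx; rewrite ffunE vx.
suff : \sum_(v | v != x) #|A :&: incident v| <= #|A|.
  by have := card_sub_incident sA cx; lia.
have -> : \sum_(v | v != x) #|A :&: incident v| =
    \sum_(v | v != x) \sum_(f in A) (if Some v \in ends f then 1 else 0).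
  apply: eq_bigr => v _; rewrite -sum1_card -big_mkcondr /=.
  by apply: eq_bigl => f; rewrite !inE.
rewrite exchange_big -sum1_card; apply: leq_sum => f fA.
have := subsetP sA _ fA; rewrite inE => xf.
rewrite -big_mkcondr /= sum1_card -ltnS -[2](card_ends f : #|ends f| = 2) (cardsD1 (Some x)) xf ltnS.
rewrite -(card_imset _ Some_inj); apply: subset_leq_card.
by apply/subsetP => _ /imsetP[v /andP[vx vf] ->]; rewrite !inE (inj_eq Some_inj) vx.
Qed.

Lemma legal0E c d : legal 0 c d -> c = d.
Proof. by move=> l; inversion l. Qed.

Lemma legalSE n c d : legal n.+1 c d ->
  exists x A, [/\ degree x < c x, A \subset incident x & legal n (topple c x A) d].
Proof. by move=> l; inversion l; subst; exists x, A. Qed.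

(* An unstable vertex has to topple sooner or later, and its first toppling
   can be moved to the front. *)
Lemma legal_exchange n c d x : legal n c d -> stable d -> degree x < c x ->
  exists A m, [/\ A \subset incident x, n = m.+1 & legal m (topple c x A) d].
Proof.
elim: n c => [|n IH] c lg sd cx.
  by move/forallP: sd => /(_ x); rewrite leqNgt -(legal0E lg) cx.
have [z [A [cz sA lg1]]] := legalSE lg.
have [zx|zx] := eqVneq z x; first by subst z; exists A, n.
have cx' : degree x < topple c z A x.
  by rewrite ffunE eq_sym (negPf zx); lia.
have [B [m [sB nE lg']]] := IH _ lg1 sd cx'.
exists B, n; split=> //; rewrite nE; apply: (@LegalS _ z A) => //.
  by rewrite ffunE (negPf zx); lia.
by rewrite -toppleC.
Qed.

Lemma legal_stable0 n c d : legal n c d -> stable c -> c = d.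
Proof.
case: n => [|n]; first by move=> /legal0E.
by move=> /legalSE[x [A [cx _ _]]] /forallP/(_ x); rewrite leqNgt cx.
Qed.

Lemma legal_cat n m c d b : legal n c d -> legal m d b -> legal (n + m) c b.
Proof. by elim=> // k x A {}c {}d cx sA _ IH /IH; apply: LegalS. Qed.

(** The grains of [g] can wait: a vertex unstable in [a] is unstable in [add_config a g], so its
    toppling can be brought to the front. Repeating this stabilises [a] first. *)
Lemma legal_abelian n a g c : legal n (add_config a g) c -> stable c ->
  exists k m b, [/\ legal k a b, stable b & legal m (add_config b g) c].
Proof.
have [m] := ubnP n; elim: m n a => // m IH n a; rewrite ltnS => nm lg sc.
have [sa|] := boolP (stable a).
  by exists 0, n, a; split; [exact: Legal0| |exact: lg].
case/stablePn=> x ax; have ax' : degree x < add_config a g x by rewrite ffunE; lia.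
have [A [n' [sA nE]]] := legal_exchange lg sc ax'; rewrite nE in nm.
rewrite topple_add // => /(IH _ _ nm)/(_ sc)[k [m' [b [lk sb lm]]]].
by exists k.+1, m', b; split=> //; apply: (LegalS ax sA).
Qed.

Lemma config_ind (P : config G -> Prop) :
  P [ffun=> 0] -> (forall c v, P c -> P (add_grain c v)) -> forall c, P c.
Proof.
move=> P0 PS c; have [n] := ubnP (\sum_v c v); elim: n c => // n IH c.
rewrite ltnS => cn; have [c0|] := boolP [forall v, c v == 0].
  suff -> : c = [ffun=> 0] by [].
  by apply/ffunP => v; rewrite ffunE; apply/eqP/(forallP c0).
rewrite negb_forall => /existsP[v cv].
have -> : c = add_grain [ffun w => c w - (w == v)] v.
  by apply/ffunP => w; rewrite !ffunE; case: eqVneq => [->|] /=; lia.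
apply/PS/IH; apply: leq_trans cn.
rewrite (bigD1 v) //= [in X in _ <= X](bigD1 v) //= ffunE eqxx.
rewrite (eq_bigr (fun w => c w)) => [|w /negPf wv]; last by rewrite ffunE wv subn0.
by rewrite ltn_add2r; lia.
Qed.

End Legal.

(** * Orientations, good configurations and backward topplings *)

Section Orientation.
Variable G : sink_graph.
Implicit Types (c d s : config G) (v w x : vertex G) (A : {set edge G}).

(* An orientation is given by the head of each edge. *)
Definition orientation (O : {ffun edge G -> option (vertex G)}) : bool :=
  [forall f, O f \in ends f].

Implicit Type O : {ffun edge G -> option (vertex G)}.

Definition indeg O (u : option (vertex G)) : nat := #|[set f | O f == u]|.

Definition outdeg O v : nat := #|[set f in incident v | O f != Some v]|.

Lemma indeg_outdeg O v : orientation O -> indeg O (Some v) + outdeg O v = degree v.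
Proof.
move=> /forallP oO; rewrite /degree -(cardsID [set f | O f == Some v]) /=.
congr (_ + _); apply: eq_card => f; rewrite !inE; last by rewrite andbC.
by case: eqP => [E|_]; rewrite ?andbF // -E oO.
Qed.

(** [s] is a reserve that each vertex holds on top of what goodness asks. *)
Definition slack c O s : Prop := forall v, s v + outdeg O v < c v.

Definition oriented c s : Prop := exists2 O, orientation O & slack c O s.

Definition good c : Prop := oriented c [ffun=> 0].

Lemma edge_other (f : edge G) (u : option (vertex G)) : u \in ends f ->
  exists2 w, w != u & ends f = [set u; w].
Proof.
move=> uf; have /eqP/cards2P[a [b [ab fE]]] := card_ends f.
move: uf; rewrite fE !inE => /orP[]/eqP->; first by exists b; rewrite // eq_sym.
by exists a; rewrite // setUC.
Qed.

(** The outdegree of [x] becomes [degree x - #|A|]; any other vertex gains outgoing edges only among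
    those that brought it a grain. *)
Lemma good_topple c x A : good c -> degree x < c x -> A \subset incident x ->
  good (topple c x A).
Proof.
case=> O oO sO cx sA.
pose away f := [pick u in ends f :\ Some x].
pose O' := [ffun f => if f \in A then Some x else
  if f \in incident x then odflt None (away f) else O f].
have awayP f : f \in incident x -> exists2 u, away f = Some u & u \in ends f :\ Some x.
  rewrite inE => /edge_other[w wx fE]; rewrite /away; case: pickP => [u uf|/(_ w)].
    by exists u.
  by rewrite fE !inE wx eqxx orbT.
have oO' : orientation O'.
  apply/forallP => f; rewrite ffunE; case: ifPn => fA.
    by have := subsetP sA _ fA; rewrite inE.
  case: ifPn => [/awayP[u -> ]|_]; last exact: (forallP oO).
  by rewrite inE => /andP[].
exists O' => // v; rewrite !ffunE add0n.
case: (eqVneq v x) => [->|vx].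
  rewrite ltn_subRL; apply: leq_trans cx; rewrite ltnS.
  rewrite /degree -(setIidPl sA) /outdeg setIC -(cardsID A (incident x)).
  rewrite leq_add2l subset_leq_card //; apply/subsetP => f; rewrite !inE ffunE.
  by case: ifP => [_|]; rewrite ?eqxx ?andbF // => _ /andP[->].
apply: leq_ltn_trans (_ : outdeg O v + #|A :&: incident v| < _); last first.
  by rewrite ltn_add2r; have := sO v; rewrite ffunE.
rewrite -[X in X <= _](cardsID A) addnC; apply: leq_add; apply/subset_leq_card/subsetP => f;
  rewrite !inE ?ffunE; last by case/andP=> /andP[-> _ ->].
case/and3P=> fA fv; rewrite (negPf fA) fv /=; case: ifPn => // fx.
have [u -> uf] /= := awayP f fx; move: uf fx fv; rewrite !inE => /andP[ux uf] fx fv.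
have [w wx fE] := edge_other fx; move: uf fv; rewrite fE !inE (negPf ux) /=.
by move=> /eqP-> /orP[/eqP[vxE]|/eqP->]; rewrite ?eqxx // vxE eqxx in vx *.
Qed.

Lemma good_le c d : good c -> (forall v, c v <= d v) -> good d.
Proof. by case=> O oO sO le; exists O => // v; apply: leq_trans (le v). Qed.

(** A backward toppling: [v] takes a grain back along each incoming edge, and these edges are
    reversed. Every other vertex loses as many grains as outgoing edges. The toppling is legal since
    [v] then holds more than [indeg O (Some v) + outdeg O v], its degree. *)
Lemma back_source c O s v : orientation O -> slack c O s ->
  exists c' O', [/\ orientation O', slack c' O' s, legal 1 c' c
    & forall f, O' f != Some v].
Proof.
move=> oO sO; pose A := [set f | O f == Some v].
have sA : A \subset incident v.
  apply/subsetP => f; rewrite !inE => /eqP <-; exact: (forallP oO).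
pose away f := [pick u in ends f :\ Some v].
pose O' := [ffun f => if f \in A then odflt None (away f) else O f].
have awayP f : f \in A -> exists2 u, away f = Some u & u \in ends f :\ Some v.
  move=> /(subsetP sA); rewrite inE => /edge_other[w wx fE].
  rewrite /away; case: pickP => [u uf|/(_ w)]; first by exists u.
  by rewrite fE !inE wx eqxx orbT.
pose c' : config G := [ffun z => if z == v then c v + #|A| else c z - #|A :&: incident z|].
have outA z : z != v -> #|A :&: incident z| + outdeg O' z = outdeg O z.
  move=> zv; rewrite {2}/outdeg -(cardsID A [set f in _ | _]).
  congr (_ + _); apply: eq_card => f.
    rewrite !in_setI in_set [f \in A]in_set andbC; case: eqP => [->|_]; rewrite ?andbF //.
    by rewrite (inj_eq Some_inj) [v == z]eq_sym zv !andbT.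
  rewrite !(in_setD, in_set, ffunE); case: ifPn => [fA'|_] //=.
  have fA : f \in A by rewrite in_set.
  have [u -> uf] /= := awayP f fA; apply/negbTE/andP => -[fz uz].
  have := subsetP sA _ fA; rewrite inE => fv; have [w wx fE] := edge_other fv.
  move: uf fz uz; rewrite !inE fE !inE (inj_eq Some_inj) (negPf zv) /=.
  by case/andP=> uv; rewrite (negPf uv) /= => /eqP-> /eqP->; rewrite eqxx.
have leA z : z != v -> #|A :&: incident z| <= c z.
  move=> zv; have := outA z zv; have := sO z; lia.
exists c', O'; split.
- apply/forallP => f; rewrite ffunE; case: ifPn => [fA|_]; last exact: (forallP oO).
  by have [u -> /=] := awayP f fA; rewrite inE => /andP[].
- move=> z; rewrite ffunE; have [->|zv] := eqVneq z v; last by have := outA z zv; have := sO z; lia.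
  have := indeg_outdeg v oO; rewrite /indeg -/A.
  have := sO v; suff : outdeg O' v <= degree v by lia.
  by apply/subset_leq_card/subsetP => f; rewrite !inE => /andP[].
- have cc' : c = topple c' v A.
    apply/ffunP => z; rewrite !ffunE; case: eqVneq => [->|zv]; first by lia.
    by have := leA z zv; lia.
  rewrite [X in legal _ _ X]cc'; apply: (@LegalS _ _ v A) => //; last exact: Legal0.
  by rewrite ffunE eqxx; have := indeg_outdeg v oO; have := sO v; rewrite /indeg -/A; lia.
- move=> f; rewrite ffunE; case: ifPn => [fA|]; last by rewrite inE.
  by have [u -> /=] := awayP f fA; rewrite !inE => /andP[].
Qed.

(** The outdegree of a source is its degree, so [v] is unstable. Undoing a toppling of [v] along [f]
    alone moves one unit of reserve from [w] to [v], with the same orientation. *)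
Lemma back_pull c O s v w f : orientation O -> (forall g, O g != Some v) ->
  v != w -> ends f = [set Some v; Some w] -> slack c O (add_grain s w) ->
  exists2 c', slack c' O (add_grain s v) & legal 1 c' c.
Proof.
move=> oO srcv vw fE sO.
have fw : O f = Some w.
  by have := forallP oO f; rewrite fE !inE (negPf (srcv f)) => /eqP.
have outv : outdeg O v = degree v.
  have := indeg_outdeg v oO; rewrite /indeg (_ : [set _ | _] = set0) ?cards0 //.
  by apply/setP => g; rewrite !inE (negPf (srcv g)).
pose c' : config G := [ffun z => c z + (z == v) - (z == w)].
have incf z : #|[set f] :&: incident z| = (z == v) + (z == w).
  rewrite (_ : _ :&: _ = if (z == v) || (z == w) then [set f] else set0).
    have [->|] := eqVneq z v; first by rewrite (negPf vw) cards1.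
    by have [_|_] := eqVneq z w; rewrite ?cards1 ?cards0.
  apply/setP => g; rewrite !inE; case: eqP => [->|] /=; last first.
    by case: ifP; rewrite !inE // => _ /eqP/negPf.
  by rewrite fE !inE !(inj_eq Some_inj); case: ifP => E; rewrite ?inE ?eqxx.
exists c'.
  move=> z; rewrite !ffunE; have := sO z; rewrite ffunE; have := sO v; rewrite ffunE.
  have [->|zv] := eqVneq z v; first by rewrite (negPf vw); lia.
  by have [->|zw] := eqVneq z w; lia.
have cc' : c = topple c' v [set f].
  apply/ffunP => z; rewrite !ffunE incf cards1.
  have := sO z; rewrite ffunE.
  have [->|zv] := eqVneq z v; first by rewrite (negPf vw); lia.
  by have [->|zw] := eqVneq z w; lia.
rewrite [X in legal _ _ X]cc'; apply: (@LegalS _ _ v [set f]) => //; last exact: Legal0.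
  by rewrite ffunE eqxx (negPf vw); have := sO v; rewrite ffunE outv; lia.
by apply/subsetP => g; rewrite !inE => /eqP->; rewrite fE !inE eqxx.
Qed.

(** Reversing [f] frees an outgoing edge of [v], and the outdegree of the sink is not
    constrained. *)
Lemma sink_slack c O s v f : orientation O -> (forall g, O g != Some v) ->
  ends f = [set Some v; None] -> slack c O s -> oriented c (add_grain s v).
Proof.
move=> oO srcv fE sO; exists [ffun g => if g == f then Some v else O g].
  apply/forallP => g; rewrite ffunE; case: eqP => [->|_]; last exact: (forallP oO).
  by rewrite fE !inE eqxx.
move=> z; apply: leq_ltn_trans (sO z); rewrite ffunE -addnA leq_add2l.
rewrite [X in _ <= X](cardsD1 f); apply: leq_add.
  by case: eqVneq => [->|//]; rewrite in_set [f \in _]in_set fE !inE eqxx srcv.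
apply/subset_leq_card/subsetP => g; rewrite !(in_setD1, in_set) ffunE.
have [->|//] := eqVneq g f; rewrite fE !inE orbF !(inj_eq Some_inj) [v == z]eq_sym.
by case: eqVneq.
Qed.

Lemma good_stableP c : stable c ->
  (exists2 O, orientation O & forall v, degree v - c v < indeg O (Some v)) <-> good c.
Proof.
move=> /forallP sc; split=> -[D oD H]; exists D => // v; have := H v;
  have := indeg_outdeg v oD; have := sc v; rewrite ?ffunE; lia.
Qed.

Hypothesis conn : graph_connected G.

Lemma sink_level : exists lev : option (vertex G) -> nat, forall v,
  exists (f : edge G) (w : option (vertex G)),
    [/\ ends f = [set Some v; w], w != Some v & lev w < lev (Some v)].
Proof.
have [|lev levP] := @connect_level _ (@Defs.adjacent G) None.
  by move=> u; exact: (forallP (forallP conn u) None).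
exists lev => v; have [w /existsP[f /eqP fE] lt] := levP (Some v) isT.
by exists f, w; split=> //; apply: contraTneq lt => ->; rewrite ltnn.
Qed.

(** Induction on the level: the unit of reserve is created at a neighbour nearer to the sink and
    pulled to [v], or comes from reversing an edge to the sink. Just before that, [v] is made a
    source. *)
Lemma back_grain c s v : oriented c s ->
  exists n c', oriented c' (add_grain s v) /\ legal n c' c.
Proof.
have [lev levP] := sink_level.
have [n] := ubnP (lev (Some v)); elim: n v c s => // n IH v c s.
rewrite ltnS => vn os; have [f [w [fE wv lt]]] := levP v.
case: w => [w|] in fE wv lt.
  have [m1 [c1 [ [D1 oO1 sO1] l1]]] := IH w c s (leq_trans lt vn) os.
  have [c2 [D2 [oO2 sO2 l2 src]]] := back_source v oO1 sO1.
  have vw : v != w by rewrite eq_sym; apply: contra wv => /eqP->.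
  have [c3 sO3 l3] := back_pull oO2 src vw fE sO2.
  by exists (1 + (1 + m1)), c3; split; [exists D2|apply: legal_cat l3 (legal_cat l2 l1)].
case: os => O oO sO.
have [c2 [D2 [oO2 sO2 l2 src]]] := back_source v oO sO.
by exists 1, c2; split=> //; apply: sink_slack src fE sO2.
Qed.

Lemma back_fill c s : good c -> exists n c', oriented c' s /\ legal n c' c.
Proof.
elim/config_ind: s => [|s v IH] gc; first by exists 0, c; split=> //; exact: Legal0.
have [n [c1 [os1 l1]]] := IH gc; have [m [c2 [os2 l2]]] := back_grain v os1.
by exists (m + n), c2; split=> //; apply: legal_cat l2 l1.
Qed.

Lemma good_reached c0 c : good c -> exists n g, legal n (add_config c0 g) c.
Proof.
(* The reserve [c0] makes [c'] dominate [c0]. *)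
move=> gc; have [n [c' [ [D _ sO] l]]] := back_fill c0 gc.
exists n, [ffun v => c' v - c0 v].
suff -> : add_config c0 [ffun v => c' v - c0 v] = c' by [].
by apply/ffunP => v; rewrite !ffunE; have := sO v; lia.
Qed.

(** Every edge points to an end of largest level, so each vertex has an incoming edge, from a
    neighbour of smaller level. *)
Lemma good_max : good [ffun v => degree v].
Proof.
have [lev levP] := sink_level.
pose O := [ffun f => if [pick u in ends f] is Some u0
  then [arg max_(u > u0 in ends f) lev u] else None].
have OP f : O f \in ends f /\ forall u, u \in ends f -> lev u <= lev (O f).
  rewrite ffunE; case: pickP => [u0 u0f|f0].
    by case: arg_maxnP.
  by have := card_ends f; rewrite eq_card0.
have oO : orientation O by apply/forallP => f; case: (OP f).
exists O => // v; rewrite !ffunE -(indeg_outdeg v oO) add0n -[X in X < _]add0n ltn_add2r.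
have [f [w [fE wv lt]]] := levP v; apply/card_gt0P; exists f; rewrite inE.
have [] := OP f; rewrite fE !inE => /orP[//|/eqP->] /(_ (Some v)).
by rewrite !inE eqxx /= leqNgt lt => /(_ isT).
Qed.

(* One grain is sent towards the sink at each toppling. *)
Lemma drain : exists phi : vertex G -> nat,
  forall c x, degree x < c x -> exists2 A : {set edge G}, A \subset incident x &
    \sum_v topple c x A v * phi v < \sum_v c v * phi v.
Proof.
(* The potential of a grain is its level, which falls when it moves from [x] to [w]. *)
have [lev levP] := sink_level; exists (fun v => lev (Some v)) => c x cx.
have [f [w [fE wv lt]]] := levP x; exists [set f].
  by apply/subsetP => g; rewrite !inE => /eqP->; rewrite fE !inE eqxx.
have incf z : #|[set f] :&: incident z| = (z == x) + (Some z == w).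
  rewrite (_ : _ :&: _ = if (z == x) || (Some z == w) then [set f] else set0).
    have [->|_] := eqVneq z x; first by rewrite [Some x == w]eq_sym (negPf wv) cards1.
    by have [_|_] := eqVneq (Some z) w; rewrite ?cards1 ?cards0.
  apply/setP => g; rewrite !inE; case: eqP => [->|] /=; last first.
    by case: ifP; rewrite !inE // => _ /eqP/negPf.
  by rewrite fE !inE !(inj_eq Some_inj); case: ifP => E; rewrite ?inE ?eqxx.
pose rest := \sum_(v | v != x) c v * lev (Some v).
rewrite (bigD1 x) //= [X in _ < X](bigD1 x) //= -/rest ffunE eqxx cards1.
have -> : \sum_(v | v != x) topple c x [set f] v * lev (Some v) =
   rest + \sum_(v | v != x) (Some v == w) * lev (Some v).
  rewrite -big_split /=; apply: eq_bigr => v vx.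
  by rewrite ffunE (negPf vx) incf (negPf vx) mulnDl.
have : \sum_(v | v != x) (Some v == w) * lev (Some v) <= lev w.
  case: (w) wv => [z zx|_]; last by rewrite big1.
  rewrite (bigD1 z) //=.
  rewrite eqxx mul1n big1 ?addn0 // => v /andP[_ vz].
  by rewrite (inj_eq Some_inj) (negPf vz).
by move: lt cx; case: (c x) => // k; rewrite subn1 /= mulSn; lia.
Qed.

End Orientation.

Local Open Scope ring_scope.

(** * Limits and a maximum principle *)

Section Limits.
Variable R : realType.

Lemma mono_cvgn (u : nat -> R) (b : R) :
  (forall n, u n <= u n.+1) -> (forall n, u n <= b) ->
  (u @ \oo --> limn u)%classic.
Proof.
move=> mu bu; apply: nondecreasing_is_cvgn; first exact/nondecreasing_seqP.
by exists b => _ [n _ <-].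
Qed.

Lemma cvgn_sum (I : finType) (P : pred I) (u : I -> nat -> R) (l : I -> R) :
  (forall i, P i -> (u i @ \oo --> l i)%classic) ->
  ((fun n => \sum_(i | P i) u i n) @ \oo --> \sum_(i | P i) l i)%classic.
Proof. by move=> H; apply: cvg_big => //; exact: add_continuous. Qed.

Lemma cvgn_eq (u v : nat -> R) (a b : R) : (u @ \oo --> a)%classic ->
  (v @ \oo --> b)%classic -> u =1 v -> a = b.
Proof.
by move=> ua vb /funext uv; rewrite uv in ua; apply: cvg_unique ua vb.
Qed.

Lemma cvgn_le (u : nat -> R) (a b : R) :
  (u @ \oo --> a)%classic -> (forall n, u n <= b) -> a <= b.
Proof. by move=> ua ub; apply: cvgr_to_le ua _; apply: nearW. Qed.

Lemma cvgn_ge (u : nat -> R) (a b : R) :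
  (u @ \oo --> a)%classic -> (forall n, b <= u n) -> b <= a.
Proof. by move=> ua ub; apply: cvgr_to_ge ua _; apply: nearW. Qed.

(* A maximum principle: if h is nonpositive at level 0 and, elsewhere, a mean
   giving weight at least eps to a point of lower level, then h <= B implies
   h <= (1 - eps ^ K) B. *)
Lemma absorbed (X : Type) (P : X -> Prop) (h : X -> R) (lev : X -> nat)
    (K : nat) (eps B0 : R) :
  0 < eps -> eps <= 1 -> 0 <= B0 ->
  (forall x, P x -> (lev x <= K)%N) -> (forall x, P x -> h x <= B0) ->
  (forall x, P x -> h x <= 0 \/ exists y, [/\ P y, (lev y < lev x)%N &
     forall B, 0 <= B -> (forall z, P z -> h z <= B) ->
       h x <= eps * h y + (1 - eps) * B]) ->
  forall x, P x -> h x <= 0.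
Proof.
move=> e0 e1 B00 levK hB0 step.
have eK0 k : 0 < eps ^+ k by apply: exprn_gt0.
have eK1 k : eps ^+ k <= 1 by apply: exprn_ile1 => //; apply: ltW.
(* One climb through the levels, from 0 up to [K], improves any uniform bound [B] by a fixed
   factor. *)
have shrink B : 0 <= B -> (forall x, P x -> h x <= B) ->
    forall x, P x -> h x <= (1 - eps ^+ K) * B.
  move=> B_0 hB; suff H k x : P x -> (lev x <= k)%N -> h x <= (1 - eps ^+ k) * B.
    by move=> x Px; apply: H => //; apply: levK.
  elim: k x => [|k IH] x Px lx.
    case: (step x Px) => [h0|[y [_ ly _]]]; last by move: (leq_trans ly lx).
    by apply: le_trans h0 _; rewrite expr0 subrr mul0r.
  case: (step x Px) => [h0|[y [Py ly /(_ B B_0 hB) hx]]].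
    by apply: le_trans h0 _; apply: mulr_ge0 => //; rewrite subr_ge0.
  apply: le_trans hx _; rewrite -lerBrDr.
  have hy := IH y Py (leq_trans ly lx).
  apply: le_trans (_ : eps * ((1 - eps ^+ k) * B) <= _); first by rewrite ler_pM2l.
  by rewrite (_ : eps * _ = (1 - eps ^+ k.+1) * B - (1 - eps) * B) // exprS; ring.
move=> x Px; pose r := 1 - eps ^+ K.
have r0 : 0 <= r by rewrite subr_ge0.
(* Repeating this gives bounds that tend to 0, since [r < 1]. *)
have hn n : forall z, P z -> h z <= r ^+ n * B0.
  elim: n => [|n IH] z Pz; first by rewrite expr0 mul1r; apply: hB0.
  by rewrite exprS -mulrA; apply: shrink => //; rewrite mulr_ge0 // exprn_ge0.
have rcvg : ((fun n => r ^+ n * B0) @ \oo --> 0 * B0)%classic.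
  apply: cvgM; last exact: cvg_cst.
  by apply: cvg_expr; rewrite ger0_norm // ltrBlDr ltrDl.
by have := cvgn_ge rcvg (fun n => hn n x Px); rewrite mul0r.
Qed.

(** * Return probabilities of a finite Markov chain *)

Section FirstVisit.
Variables (S : finType) (T : S -> S -> R) (c : S) (u : nat -> S -> R).
Hypothesis T_ge0 : forall a b, 0 <= T a b.
Hypothesis T_sum1 : forall a, \sum_b T a b = 1.
(** [u n a] stands for the probability that the chain started at [a] visits [c] at one of the times
    1 to [n]; the recursion conditions on the first step. *)
Hypothesis u0 : forall a, u 0%N a = 0.
Hypothesis uS : forall n a, u n.+1 a = T a c + \sum_(b | b != c) T a b * u n b.

Lemma visit_ge0 n a : 0 <= u n a.
Proof.
elim: n a => [|n IH] a; first by rewrite u0.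
by rewrite uS addr_ge0 // sumr_ge0 // => b _; rewrite mulr_ge0.
Qed.

Lemma visit_le1 n a : u n a <= 1.
Proof.
elim: n a => [|n IH] a; first by rewrite u0.
rewrite uS -(T_sum1 a) [leRHS](bigD1 c) //= lerD2l.
by apply: ler_sum => b _; rewrite ler_piMr.
Qed.

Lemma visit_mono n a : u n a <= u n.+1 a.
Proof.
elim: n a => [|n IH] a; first by rewrite u0 visit_ge0.
by rewrite 2!uS lerD2l; apply: ler_sum => b _; rewrite ler_wpM2l.
Qed.

(** The probability of never visiting [c] is the mean, after one step, of a function [h] that
    vanishes at [c]. Since every state leads to [c], the maximum principle gives [h <= 0], and then
    [U c = 1]. *)
Lemma visit_cvg1 : (forall a, connect [rel x y | 0 < T x y] a c) ->
  ((fun n => u n c) @ \oo --> (1 : R))%classic.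
Proof.
move=> conn; have [lev levP] := connect_level conn.
pose U a := limn (fun n => u n a).
have Ucvg a : ((fun n => u n a) @ \oo --> U a)%classic.
  by apply: (@mono_cvgn _ 1) => n; [exact: visit_mono|exact: visit_le1].
have UE a : U a = T a c + \sum_(b | b != c) T a b * U b.
  have := Ucvg a; rewrite -cvg_shiftS /= => H.
  apply: cvgn_eq H _ (fun n => uS n a); apply: cvgD; first exact: cvg_cst.
  by apply: cvgn_sum => b _; apply: cvgM; [exact: cvg_cst|exact: Ucvg].
pose h a := if a == c then 0 else 1 - U a.
have hE a : 1 - U a = \sum_b T a b * h b.
  rewrite UE -[X in X - _](T_sum1 a) (bigD1 c) //= opprD addrACA subrr add0r.
  rewrite [RHS](bigD1 c) //= /h eqxx mulr0 add0r -sumrB.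
  by apply: eq_bigr => b /negPf ->; rewrite mulrBr mulr1.
have h1 a : h a <= 1.
  rewrite /h; case: ifP => // _; rewrite gerBl.
  by apply: cvgn_ge (Ucvg a) _ => n; apply: visit_ge0.
have h_le0 a : h a <= 0.
  pose eps := \big[Order.min/1]_(p : S * S | 0 < T p.1 p.2) T p.1 p.2.
  have epsP x y : 0 < T x y -> eps <= T x y.
    by move=> xy; rewrite /eps (bigD1 (x, y)) //= ge_min lexx.
  apply: (@absorbed S (fun=> True) h lev (\max_b lev b) eps 1) => //.
  - by rewrite /eps; elim/big_ind: _ => // x y x0 y0; rewrite lt_min x0.
  - rewrite /eps; elim/big_ind: _ => // [x y x0 y0|[x y] _]; first by rewrite ge_min x0.
    by rewrite -(T_sum1 x) (bigD1 y) //= lerDl sumr_ge0.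
  - by move=> x _; apply: leq_bigmax.
  move=> x _; have [->|xc] := eqVneq x c; first by left; rewrite /h eqxx.
  right; have [y /= Txy ly] := levP x xc; exists y; split=> // B B0 hB.
  rewrite {1}/h (negPf xc) hE (bigD1 y) //=.
  (* Beyond the weight [eps] given to [y], the remaining weights add up to [1 - eps], and there [h]
     is bounded by [B]. *)
  have -> : 1 - eps = T x y - eps + \sum_(b | b != y) T x b.
    by rewrite -(T_sum1 x) (bigD1 y) //= addrAC.
  rewrite mulrDl addrA lerD //.
    rewrite -subr_ge0 (_ : _ - _ = (T x y - eps) * (B - h y)); last by ring.
    by rewrite mulr_ge0 ?subr_ge0 ?epsP ?hB.
  by rewrite mulr_suml; apply: ler_sum => b _; rewrite ler_wpM2l ?hB.
suff <- : U c = 1 by exact: Ucvg.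
apply/eqP; rewrite eq_le; apply/andP; split.
  by apply: cvgn_le (Ucvg c) _ => n; apply: visit_le1.
rewrite -subr_le0 hE sumr_le0 // => b _; exact: mulr_ge0_le0.
Qed.

(** From the closed set [D] the chain never visits [c]. A path from [c] into [D] that does not come
    back to [c] is followed with positive probability, which is lost for the return. *)
Lemma visit_lt1 (D : pred S) (d : S) :
  D d -> ~~ D c -> (forall a b, D a -> 0 < T a b -> D b) ->
  connect [rel x y | 0 < T x y] c d ->
  ~ ((fun n => u n c) @ \oo --> (1 : R))%classic.
Proof.
move=> Dd nDc Dclosed /connectP[p0 path0 dE].
have D0 n a : D a -> u n a = 0.
  elim: n a => [|n IH] a Da; first by rewrite u0.
  have T0 b : ~~ D b -> T a b = 0.
    move=> nDb; apply/eqP; rewrite eq_le T_ge0 andbT leNgt.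
    by apply: contra nDb; apply: Dclosed.
  rewrite uS T0 // add0r big1 // => b _.
  by have [/IH->|/T0->] := boolP (D b); rewrite ?mulr0 ?mul0r.
move: dE; case/shortenP: path0 => p pathp /= /andP[cp _] _ dE.
have bound : exists2 eps : R, 0 < eps & forall n, u n c <= 1 - eps.
  (* The start of the path is generalised, but not the state [c] that the path avoids; each step
     multiplies [eps] by its probability. *)
  elim: p {1 3 4}c pathp cp dE => [|b p IH] a /=.
    by move=> _ _ dE; exists 1 => // n; rewrite D0 ?subrr // -dE.
  case/andP=> Tab pathp; rewrite inE negb_or => /andP[cb cp] dE.
  have [eps e0 ubnd] := IH b pathp cp dE.
  exists (T a b * eps) => [|n]; first exact: mulr_gt0.
  case: n => [|n].
    by rewrite u0 subr_ge0 -[1](T_sum1 a) (bigD1 b) //= -[leLHS]addr0 lerD //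
      ?sumr_ge0 // ler_piMr //; have := ubnd 0%N; rewrite u0 subr_ge0.
  rewrite uS -[X in X - _](T_sum1 a) [in leRHS](bigD1 c) //= -addrA lerD2l.
  rewrite (bigD1 b) 1?eq_sym //= [in leRHS](bigD1 b) 1?eq_sym //= addrAC lerD //.
    by rewrite -[X in X - _]mulr1 -mulrBr ler_wpM2l.
  by apply: ler_sum => z _; rewrite ler_piMr // visit_le1.
have [eps e0 ub] := bound => /cvgn_le/(_ ub).
by rewrite lerBrDl gerDr leNgt e0.
Qed.

End FirstVisit.

End Limits.

(** * Recurrent states of the sandpile chain *)

Section Sandpile.
Variables (R : realType) (G : sink_graph) (M : sandpile R G).
Implicit Types (c : config G) (d a b : stable_config G) (x v : vertex G).
Implicit Types (A : {set edge G}) (n : nat).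

Local Notation stab := (stabilize_within M).

Lemma topple_weight_gt0 x A : 0 < topple_weight M x A.
Proof.
by rewrite mulr_gt0 ?exprn_gt0 ?subr_gt0 ?topple_prob_gt0 ?topple_prob_lt1.
Qed.

Lemma topple_weight_sum1 x :
  \sum_(A : {set edge G} | A \subset incident x) topple_weight M x A = 1.
Proof.
pose q := 1 - topple_prob M.
rewrite -[RHS](expr1n _ (degree x)) -[X in X ^+ _](subrK (topple_prob M)) -/q.
rewrite GRing.exprDn (partition_big (fun A => inord #|A| : 'I_(degree x).+1) predT) //=.
apply: eq_bigr => k _; rewrite -cards_draws -sumr_const.
apply: eq_big => [A|A /andP[sA /eqP kE]].
  rewrite inE; have [sA|//] := boolP (A \subset incident x) => /=.
  by rewrite -val_eqE /= inordK // ltnS subset_leq_card.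
have <- : #|A| = k by rewrite -kE inordK // ltnS subset_leq_card.
by rewrite /topple_weight mulrC.
Qed.

Lemma stab_stable n c d : stable c -> stab n c d = (c == to_config d)%:R.
Proof. by case: n => [|n] /= ->. Qed.

Lemma stab0_unstable c d : ~~ stable c -> stab 0 c d = 0.
Proof. by move=> /negPf /= ->. Qed.

Lemma stabS_unstable n c d : ~~ stable c -> let x := topple_rule M c in
  stab n.+1 c d = \sum_(A : {set edge G} | A \subset incident x)
    topple_weight M x A * stab n (topple c x A) d.
Proof. by move=> /negPf /= ->. Qed.

Lemma stab_ge0 n c d : 0 <= stab n c d.
Proof.
elim: n c => [|n IH] c; have [sc|nsc] := boolP (stable c);
  rewrite ?(stab_stable _ _ sc) ?ler0n ?stab0_unstable //.
by rewrite stabS_unstable // sumr_ge0 // => A _; rewrite mulr_ge0 // ltW ?topple_weight_gt0.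
Qed.

Lemma stab_mono n c d : stab n c d <= stab n.+1 c d.
Proof.
elim: n c => [|n IH] c; have [sc|nsc] := boolP (stable c);
  rewrite ?(stab_stable _ _ sc) // ?stab0_unstable ?stab_ge0 //.
rewrite 2?stabS_unstable //; apply: ler_sum => A _.
by rewrite ler_wpM2l // ltW ?topple_weight_gt0.
Qed.

Lemma stable_to_config d : stable (to_config d).
Proof. by apply/forallP => v; rewrite ffunE -ltnS. Qed.

Lemma to_config_inj : injective (@to_config G).
Proof. by move=> a b /ffunP E; apply/ffunP => v; apply: val_inj; have := E v; rewrite !ffunE. Qed.

Lemma stable_ex c : stable c -> exists d, c = to_config d.
Proof.
move=> /forallP sc; exists [ffun v => inord (c v) : 'I_(degree v).+1].
by apply/ffunP => v; rewrite !ffunE inordK // ltnS.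
Qed.

Lemma stable_sum1 c : stable c -> \sum_d (c == to_config d)%:R = 1 :> R.
Proof.
move=> /stable_ex[d ->]; rewrite (bigD1 d) //= eqxx big1 ?addr0 // => b bd.
by rewrite (inj_eq to_config_inj) eq_sym (negPf bd).
Qed.

Lemma stab_sum_le1 n c : \sum_d stab n c d <= 1.
Proof.
elim: n c => [|n IH] c; have [sc|nsc] := boolP (stable c).
1,3: by under eq_bigr do rewrite stab_stable //; rewrite stable_sum1.
  by rewrite big1 // => d _; apply: stab0_unstable.
under eq_bigr do rewrite stabS_unstable //.
rewrite exchange_big /= -(topple_weight_sum1 (topple_rule M c)).
apply: ler_sum => A _; rewrite -mulr_sumr ler_piMr // ltW //.
exact: topple_weight_gt0.
Qed.

Lemma stab_le1 n c d : stab n c d <= 1.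
Proof.
apply: le_trans (stab_sum_le1 n c); rewrite (bigD1 d) //= lerDl.
by rewrite sumr_ge0 // => b _; apply: stab_ge0.
Qed.

Lemma stabilize_cvg c d :
  ((fun n => stab n c d) @ \oo --> stabilize_prob M c d)%classic.
Proof.
by apply: (@mono_cvgn _ _ 1) => n; [exact: stab_mono|exact: stab_le1].
Qed.

Arguments stabilize_cvg : clear implicits.

Lemma stabilize_ge n c d : stab n c d <= stabilize_prob M c d.
Proof.
have cv := stabilize_cvg c d.
apply: (@nondecreasing_cvgn_le _ (fun n => stab n c d)).
  by apply/nondecreasing_seqP => k; exact: stab_mono.
by apply/cvg_ex; exists (stabilize_prob M c d).
Qed.

Lemma stabilize_ge0 c d : 0 <= stabilize_prob M c d.
Proof. exact: le_trans (stab_ge0 0 c d) (stabilize_ge 0 c d). Qed.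

Lemma stabilize_stable c d : stable c -> stabilize_prob M c d = (c == to_config d)%:R.
Proof.
move=> sc; apply: cvgn_eq (stabilize_cvg c d) _ (fun n => stab_stable n d sc).
exact: cvg_cst.
Qed.

Lemma stabilize_unstable c d : ~~ stable c -> let x := topple_rule M c in
  stabilize_prob M c d = \sum_(A : {set edge G} | A \subset incident x)
    topple_weight M x A * stabilize_prob M (topple c x A) d.
Proof.
move=> nsc x; have := stabilize_cvg c d; rewrite -cvg_shiftS /= => H.
apply: cvgn_eq H _ (fun n => stabS_unstable n d nsc).
by apply: cvgn_sum => A _; apply: cvgM; [exact: cvg_cst|exact: stabilize_cvg].
Qed.

Lemma stabilize_sum_le1 c : \sum_d stabilize_prob M c d <= 1.
Proof.
have cv : ((fun n => \sum_d stab n c d) @ \oo --> \sum_d stabilize_prob M c d)%classic.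
  by apply: cvgn_sum => d _; exact: stabilize_cvg.
exact: cvgn_le cv (fun n => stab_sum_le1 n c).
Qed.

(** The rule need not follow the given sequence, but a toppling of the vertex it chooses can be
    moved to the front without changing the length. *)
Lemma stab_legal n c d : legal n c (to_config d) -> 0 < stab n c d.
Proof.
elim: n c => [|n IH] c l.
  by rewrite (legal0E l) stab_stable ?stable_to_config // eqxx ltr01.
have [sc|nsc] := boolP (stable c).
  by rewrite (legal_stable0 l sc) stab_stable ?stable_to_config // eqxx ltr01.
rewrite stabS_unstable //.
have [A [m [sA [nE] l']]] := legal_exchange l (stable_to_config d) (topple_ruleP M nsc).
rewrite -nE in l'.
rewrite (bigD1 A) //= ltr_pwDl //.
  by rewrite mulr_gt0 ?topple_weight_gt0 ?IH.
by rewrite sumr_ge0 // => B _; rewrite mulr_ge0 ?stab_ge0 // ltW ?topple_weight_gt0.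
Qed.

Lemma stab_good n c d : good c -> ~ good (to_config d) -> stab n c d = 0.
Proof.
move=> gc ngd; elim: n c gc => [|n IH] c gc; have [sc|nsc] := boolP (stable c).
1,3: by rewrite stab_stable //; case: eqP => // E; case: ngd; rewrite -E.
  exact: stab0_unstable.
rewrite stabS_unstable // big1 // => A sA; rewrite IH ?mulr0 //.
by apply: good_topple => //; apply: topple_ruleP.
Qed.

Lemma transition_ge0 a b : 0 <= transition M a b.
Proof.
by rewrite sumr_ge0 // => v _; rewrite mulr_ge0 ?stabilize_ge0 // ltW ?grain_law_gt0.
Qed.

Lemma transition_gt0 n v a b : legal n (add_grain (to_config a) v) (to_config b) ->
  0 < transition M a b.
Proof.
move=> l; rewrite /transition (bigD1 v) //= ltr_pwDl //.
  by rewrite mulr_gt0 ?grain_law_gt0 // (lt_le_trans (stab_legal l)) ?stabilize_ge.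
by rewrite sumr_ge0 // => w _; rewrite mulr_ge0 ?stabilize_ge0 // ltW ?grain_law_gt0.
Qed.

Lemma transition_good a b : good (to_config a) -> 0 < transition M a b ->
  good (to_config b).
Proof.
move=> ga; have [//|ngb] := pselect (good (to_config b)).
rewrite /transition big1 ?ltxx // => v _.
rewrite (_ : stabilize_prob _ _ _ = 0) ?mulr0 //.
apply: (cvgn_eq (stabilize_cvg _ b) (cvg_cst (0 : R))) => n; apply: stab_good => //.
by apply: good_le ga _ => w; rewrite [add_grain _ _ _]ffunE leq_addr.
Qed.

(** The grains of [g] are added one by one: after each addition the abelian property allows
    stabilising at once and leaves the other grains for later steps of the chain. *)
Lemma connect_legal n a g b :
  legal n (add_config (to_config a) g) (to_config b) ->
  connect [rel p q | 0 < transition M p q] a b.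
Proof.
elim/config_ind: g a n => [|g v IH] a n l.
  suff -> : a = b by exact: connect0.
  apply: to_config_inj; rewrite -(legal_stable0 l); first by apply/ffunP => v; rewrite !ffunE addn0.
  by apply/forallP => v; rewrite !ffunE addn0 -ltnS.
have E : add_config (to_config a) (add_grain g v) =
    add_config (add_grain (to_config a) v) g.
  by apply/ffunP => w; rewrite !ffunE addnA addnAC.
rewrite E in l.
have [k [m [c [lk sc lm]]]] := legal_abelian l (stable_to_config b).
have [a1 a1E] := stable_ex sc; rewrite a1E in lk lm.
by apply: connect_trans (IH _ _ lm); apply: connect1; apply: transition_gt0 lk.
Qed.

Hypothesis conn : graph_connected G.

(** The defect [h] is 0 on stable configurations and elsewhere a mean over topplings. Some toppling,
    of weight at least [eps], lowers the potential of [drain], so the maximum principle applies. *)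
Lemma stabilize_sum1 c : \sum_d stabilize_prob M c d = 1.
Proof.
have [phi phiP] := drain conn.
pose p := topple_prob M; pose N := (\sum_v c v)%N.
have p0 : 0 < p := topple_prob_gt0 M; have p1 : p < 1 := topple_prob_lt1 M.
pose eps := (p * (1 - p)) ^+ #|edge G|.
have pq0 : 0 < p * (1 - p) by rewrite mulr_gt0 ?subr_gt0.
have pq1 : p * (1 - p) <= 1 by rewrite mulr_ile1 ?subr_ge0 ?gerBl // ltW.
have epsP x A : A \subset incident x -> eps <= topple_weight M x A.
  move=> sA; rewrite /eps exprMn /topple_weight -/p.
  have q0 : 0 <= 1 - p by rewrite subr_ge0 ltW.
  apply: ler_pM.
  - exact: exprn_ge0 (ltW p0).
  - exact: exprn_ge0 q0.
  - exact: (ler_wiXn2l (ltW p0) (ltW p1) (max_card _)).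
  - apply: ler_wiXn2l => //; first by rewrite gerBl ltW.
    exact: leq_trans (leq_subr _ _) (max_card _).
apply/eqP; rewrite eq_le stabilize_sum_le1 -subr_le0 /=.
pose h c' := 1 - \sum_d stabilize_prob M c' d.
have h_ge0 c' : 0 <= h c' by rewrite subr_ge0 stabilize_sum_le1.
have h_unst c' : ~~ stable c' -> let x := topple_rule M c' in
    h c' = \sum_(A : {set edge G} | A \subset incident x)
      topple_weight M x A * h (topple c' x A).
  move=> nsc x; rewrite /h; under eq_bigr do rewrite stabilize_unstable //.
  rewrite exchange_big /= -[X in X - _](topple_weight_sum1 x) -sumrB.
  by apply: eq_bigr => A _; rewrite mulrBr mulr1 mulr_sumr.
(* Topplings create no grains, so one can stay among configurations of at most [N] grains, where the
   potential is bounded. *)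
apply: (@absorbed _ _ (fun c' => \sum_v c' v <= N)%N h
  (fun c' => \sum_v c' v * phi v)%N (N * \sum_v phi v) eps 1) => //.
- exact: exprn_gt0.
- by apply: exprn_ile1 => //; apply: ltW.
- move=> c' cN; rewrite big_distrr /=; apply: leq_sum => v _.
  by rewrite leq_mul2r (leq_trans _ cN) ?orbT // (bigD1 v) //= leq_addr.
- by move=> c' _; rewrite gerBl sumr_ge0 // => d _; apply: stabilize_ge0.
move=> c' cN; have [sc|nsc] := boolP (stable c').
  left; rewrite /h; under eq_bigr do rewrite stabilize_stable //.
  by rewrite stable_sum1 // subrr.
right; pose x := topple_rule M c'; have cx := topple_ruleP M nsc.
have [A sA lt] := phiP c' x cx; exists (topple c' x A); split=> //.
  by apply: leq_trans cN; apply: topple_total.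
move=> B B0 hB; rewrite h_unst // (bigD1 A) //=.
have -> : 1 - eps = topple_weight M x A - eps +
    \sum_(E : {set edge G} | (E \subset incident x) && (E != A)) topple_weight M x E.
  by rewrite -(topple_weight_sum1 x) (bigD1 A) //= addrAC.
rewrite mulrDl addrA lerD //.
  rewrite -subr_ge0 (_ : _ - _ = (topple_weight M x A - eps) * (B - h (topple c' x A)));
    last by rewrite -/x; ring.
  rewrite mulr_ge0 ?subr_ge0 ?epsP ?hB //.
  by apply: leq_trans cN; apply: topple_total.
rewrite mulr_suml; apply: ler_sum => E /andP[sE _].
rewrite ler_wpM2l ?hB // ?ltW ?topple_weight_gt0 //.
by apply: leq_trans cN; apply: topple_total.
Qed.

Lemma transition_sum1 a : \sum_b transition M a b = 1.
Proof.
rewrite exchange_big /= -(grain_law_sum1 M); apply: eq_bigr => v _.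
by rewrite -mulr_sumr stabilize_sum1 mulr1.
Qed.

Lemma first_visitS n a d : series (fun k => first_visit M k a d) n.+1 =
  transition M a d +
  \sum_(b | b != d) transition M a b * series (fun k => first_visit M k b d) n.
Proof.
rewrite /series /= big_nat_recl //=; congr (_ + _).
by rewrite exchange_big /=; apply: eq_bigr => b _; rewrite mulr_sumr.
Qed.

(** If [d] is not good, it leads to the maximal configuration, which is good, and goodness is never
    lost: the return is not sure. If [d] is good, it is reached from every state. *)
Theorem recurrentP d : recurrent M d <-> good (to_config d).
Proof.
pose u n a := series (fun k => first_visit M k a d) n.
have u0 a : u 0%N a = 0 by rewrite /u /series /= big_geq.
have uS n a : u n.+1 a = transition M a d + \sum_(b | b != d) transition M a b * u n b.
  exact: first_visitS.
split=> [rec|gd].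
  have [//|ngd] := pselect (good (to_config d)).
  have max_stable : @stable G [ffun v => degree v] by apply/forallP => v; rewrite ffunE.
  have [m mE] := stable_ex max_stable.
  pose D := [pred a : stable_config G | `[< good (to_config a) >]].
  case: (@visit_lt1 _ _ _ d u transition_ge0 transition_sum1 u0 uS D m _ _ _ _ rec).
  - by apply/asboolP; rewrite -mE; exact: good_max.
  - by apply/asboolPn.
  - by move=> a b /asboolP ga /(transition_good ga) gb; apply/asboolP.
  - apply: (@connect_legal 0 _ [ffun v => degree v - d v]%N).
    rewrite -mE (_ : add_config _ _ = [ffun v => degree v]); first exact: Legal0.
    by apply/ffunP => v; rewrite !ffunE subnKC // -ltnS.
apply: (@visit_cvg1 _ _ _ d u transition_ge0 transition_sum1 u0 uS) => a.
by have [n [g l]] := good_reached conn (to_config a) gd; apply: connect_legal l.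
Qed.

End Sandpile.

Local Open Scope nat_scope.

(** * Indegree vectors and their exchange property *)

Section Realizable.
Variable G : sink_graph.
Implicit Types (u w z : option (vertex G)) (v x y : vertex G).
Implicit Types (D : {ffun edge G -> option (vertex G)}) (n : vertex G -> nat).

Lemma indeg_flip D f z : D f != z -> forall v : option (vertex G),
  indeg [ffun g => if g == f then z else D g] v + (v == D f) = indeg D v + (v == z).
Proof.
move=> fz v; rewrite /indeg (cardsD1 f) [in RHS](cardsD1 f) !inE ffunE eqxx.
rewrite (_ : [set g | _] :\ f = [set g | D g == v] :\ f); last first.
  by apply/setP => g; rewrite !inE ffunE; case: eqVneq.
by rewrite !(eq_sym v) addnAC [RHS]addnC addnA addnAC.
Qed.

(* Flip in O1 an edge that O2 points to z; if its former head u does not have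
   spare indegree, it lacks one now, and the flips go on from u. *)
Lemma indeg_exchange O1 O2 z : @orientation G O1 -> @orientation G O2 ->
  indeg O1 z < indeg O2 z ->
  exists D w, [/\ orientation D, indeg O2 w < indeg O1 w &
    forall v : option (vertex G), indeg D v + (v == w) = indeg O1 v + (v == z)].
Proof.
(* Induction on the number of edges on which the orientations differ. *)
move=> oO1 oO2; have [k] := ubnP #|[set f | O1 f != O2 f]|.
elim: k O1 oO1 z => // k IH O1 oO1 z; rewrite ltnS => lek lt.
have [f /andP[f2 f1]] : exists f, (O2 f == z) && (O1 f != z).
  apply/existsP; apply: contraLR lt; rewrite negb_exists => /forallP no; rewrite -leqNgt.
  apply/subset_leq_card/subsetP => f; rewrite !inE => f2.
  by have := no f; rewrite f2 negbK.
pose D := [ffun g => if g == f then z else O1 g].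
have oD : orientation D.
  apply/forallP => g; rewrite ffunE; case: eqP => [->|_]; last exact: (forallP oO1).
  by rewrite -(eqP f2); apply: (forallP oO2).
have inD u : indeg D u + (u == O1 f) = indeg O1 u + (u == z) by exact: indeg_flip.
have [ltu|leu] := ltnP (indeg O2 (O1 f)) (indeg O1 (O1 f)).
  by exists D, (O1 f).
have ltk : #|[set g | D g != O2 g]| < k.
  apply: leq_trans lek; apply: proper_card; apply/properP; split.
    apply/subsetP => g; rewrite !inE ffunE; have [->|//] := eqVneq g f.
    by rewrite eq_sym f2.
  by exists f; rewrite !inE ?ffunE ?eqxx (eqP f2) ?eqxx.
have [|E [w [oE ltw inE]]] := IH D oD (O1 f) ltk.
  by have := inD (O1 f); rewrite eqxx (negPf f1); lia.
exists E, w; split=> // [|v]; last by have := inD v; have := inE v; lia.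
by have := inD w; have [wz|_] := eqVneq w z; [subst w; lia|lia].
Qed.

Definition realizable n : Prop :=
  exists2 D, orientation D & forall v, n v <= indeg D (Some v).

Lemma realizable_le n1 n2 : realizable n2 -> (forall v, n1 v <= n2 v) -> realizable n1.
Proof. by case=> D oD H le; exists D => // v; apply: leq_trans (H v). Qed.

(** If the realisation of [n1] has an indegree to spare at [x], it serves again. Otherwise the
    exchange adds one at [x] and takes one from some [w] with [indeg O2 w < indeg O1 w]. A vertex
    [w] other than [y] can spare it because [n1 w <= n2 w], and [y] is allowed to lose one. *)
Lemma realizable_exchange n1 n2 x y : realizable n1 -> realizable n2 ->
  x != y -> n1 x < n2 x -> (forall v, v != y -> n1 v <= n2 v) ->
  realizable (fun v => n1 v + (v == x) - (v == y)).
Proof.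
case=> O1 oO1 H1 [ O2 oO2 H2] xy lt le.
have [lt1|ge1] := ltnP (n1 x) (indeg O1 (Some x)).
  exists O1 => // v; have := H1 v; have [->|_] := eqVneq v x.
    by rewrite (negPf xy); lia.
  by lia.
have [|D [w [oD ltw inD]]] := @indeg_exchange O1 O2 (Some x) oO1 oO2.
  by have := H2 x; lia.
exists D => // v; have := inD (Some v); have := H1 v; have := H2 v.
rewrite (inj_eq Some_inj); have [->|vx] := eqVneq v x.
  rewrite (negPf xy); have := le x xy.
  by have [E|_] := eqVneq (Some x) w; [move: ltw; rewrite -E|]; lia.
have [->|/le] := eqVneq v y; first by case: (Some y == w) => /=; lia.
by have [E|_] := eqVneq (Some v) w; [move: ltw; rewrite -E|]; lia.
Qed.

Lemma realizable_le_degree n v : realizable n -> n v <= degree v.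
Proof. by case=> D oD /(_ v); have := indeg_outdeg v oD; lia. Qed.

End Realizable.

(* A configuration is encoded by the numbers of grains it lacks. *)
Definition lacks (G : sink_graph) : set (config G) :=
  [set l | realizable (fun v => (l v).+1)].
Arguments lacks : clear implicits.

Lemma finite_lacks (G : sink_graph) : finite_set (lacks G).
Proof.
pose h (c : stable_config G) : config G := [ffun v => degree v - c v].
apply: (@sub_finite_set _ _ (h @` [set: _]%classic)); last exact/finite_image/finite_finset.
move=> l lr; exists [ffun v => inord (degree v - l v) : 'I_(degree v).+1] => //.
apply/ffunP => v; rewrite !ffunE inordK ?ltnS ?leq_subr // subKn //.
exact: ltnW (realizable_le_degree v lr).
Qed.

(** Probability ends here: taking complements to the degrees carries recurrent configurations to
    [lacks G], and the strict indegree bound becomes the successor in that set. *)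
Lemma lacking_polyE (R : realType) (G : sink_graph) (M : sandpile R G) :
  graph_connected G ->
  lacking_poly M = (\sum_(l \in lacks G) ('X^(\sum_v l v)%N : {poly int}))%R.
Proof.
move=> conn; pose h (c : stable_config G) : config G := [ffun v => degree v - c v].
pose S : set (stable_config G) := [set` Sto M]%classic.
rewrite /lacking_poly bigfs; last first.
- by move=> c _; rewrite mem_index_enum.
- exact: index_enum_uniq.
rewrite (@reindex_fsbig _ _ _ _ _ h S).
  by apply: eq_fsbigr => c _; congr ('X^_)%R; apply: eq_bigr => v _; rewrite ffunE.
have goodP c : S c <-> lacks G (h c).
  rewrite /S /= inE; split.
    move=> /asboolP/(recurrentP M conn)/(good_stableP (stable_to_config c))[D oD H].
    by exists D => // v; rewrite !ffunE; have := H v; rewrite ffunE.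
  case=> D oD H; apply/asboolP/(recurrentP M conn)/(good_stableP (stable_to_config c)).
  by exists D => // v; have := H v; rewrite !ffunE.
have leS (c : stable_config G) v : c v <= degree v by rewrite -ltnS.
split=> [c /goodP//|c d _ _ /ffunP E|l lr].
  apply/ffunP => v; apply: val_inj => /=; have := E v; rewrite !ffunE => Ev.
  by rewrite -[RHS](subKn (leS d v)) -[LHS](subKn (leS c v)) Ev.
have le v : l v <= degree v by exact: ltnW (realizable_le_degree v lr).
pose c : stable_config G := [ffun v => inord (degree v - l v) : 'I_(degree v).+1].
have hc : h c = l.
  by apply/ffunP => v; rewrite !ffunE inordK ?ltnS ?leq_subr // subKn.
by exists c => //; apply/goodP; rewrite hc.
Qed.

(** * Indegrees under deletion and contraction of an edge *)

Section DeletionContraction.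
Variables (G : sink_graph) (e : edge G) (x y : vertex G).
Hypotheses (xy : x != y) (endsE : ends e = [set Some x; Some y]).
Implicit Types (u z : option (vertex G)) (v : vertex G) (n : vertex G -> nat).
Implicit Types (D : {ffun edge G -> option (vertex G)}).

Lemma indeg_delete D u :
  @indeg (delete_edge e) [ffun f => D (val f)] u + (D e == u) = indeg D u.
Proof.
rewrite /indeg [RHS](cardsD1 e) inE addnC; congr (_ + _).
rewrite -(card_imset _ val_inj); apply: eq_card => f; rewrite !inE.
apply/imsetP/andP => [[g]|[fe fu]].
  by rewrite inE ffunE => gu ->; split=> //; apply: (valP g).
by exists (Sub f fe); rewrite ?inE ?ffunE ?SubK.
Qed.

Lemma realizable_delete n : realizable n ->
  @realizable (delete_edge e) (fun v => n v - (v == x)) \/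
  @realizable (delete_edge e) (fun v => n v - (v == y)).
Proof.
case=> D oD H; pose D' : {ffun edge (delete_edge e) -> _} := [ffun f => D (val f)].
have oD' : orientation D' by apply/forallP => f; rewrite ffunE; apply: (forallP oD).
have := forallP oD e; rewrite endsE !inE => /orP[]/eqP De; [left|right];
  by exists D' => // v; rewrite leq_subLR addnC eq_sym -(inj_eq Some_inj) -De indeg_delete.
Qed.

Lemma realizable_undelete n v : Some v \in ends e ->
  @realizable (delete_edge e) n -> realizable (fun w => n w + (w == v)).
Proof.
move=> ve [D oD H].
pose D' := [ffun f => if insub f is Some g then D g else Some v].
have D'E : D = [ffun f => D' (val f)] by apply/ffunP => f; rewrite !ffunE valK.
have D'e : D' e = Some v by rewrite ffunE insubF ?eqxx.
exists D' => [|w].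
  apply/forallP => f; have [->|fe] := eqVneq f e; first by rewrite D'e.
  by rewrite ffunE (insubT (fun f => f != e) fe); apply: (forallP oD).
rewrite -indeg_delete D'e (inj_eq Some_inj) [v == w]eq_sym leq_add2r.
by apply: leq_trans (H w) _; rewrite {1}D'E.
Qed.

(** If [e] points to [y] in the realisation of [n], or to [x] in that of the shifted vector,
    deleting it is enough. Otherwise [n] less one at [x], and [n] plus one at [x] less two at [y],
    are realised without [e]; an exchange between them gives [n] less one at [y]. *)
Lemma realizable_delete_shift n : realizable n ->
  realizable (fun v => n v + (v == x) - (v == y)) -> 0 < n x -> 1 < n y ->
  @realizable (delete_edge e) (fun v => n v - (v == y)).
Proof.
move=> /realizable_delete[r1|//] /realizable_delete[r2|r2] nx ny.
  by apply: realizable_le r2 _ => v; case: eqVneq => [->|_]; rewrite ?(negPf xy); lia.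
have xy' := negPf xy; apply: realizable_le (realizable_exchange r1 r2 xy _ _) _.
- by rewrite !eqxx xy'; lia.
- by move=> v /negPf->; lia.
by move=> v /=; have [->|vx] := eqVneq v x; [rewrite xy'|]; lia.
Qed.

Definition merged v : contract_vertex e := if insub v is Some w then inl w else inr tt.

Lemma merge_inl (w : {v : vertex G | Some v \notin ends e}) v :
  (merged v == inl w) = (v == val w).
Proof.
rewrite /merged; case: insubP => [w' _ wv|nv]; first by rewrite -wv.
by apply/esym; apply: contraNF nv => /eqP->; apply: (valP w).
Qed.

Lemma merge_inr v : (merged v == inr tt) = (v == x) || (v == y).
Proof.
rewrite -[RHS](_ : (Some v \in ends e) = _); last by rewrite endsE !inE !(inj_eq Some_inj).
by rewrite /merged; case: insubP => [w /negPf->|/negbNE->].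
Qed.

Lemma sum_merge_inl (w : {v : vertex G | Some v \notin ends e}) n :
  \sum_(v | merged v == inl w) n v = n (val w).
Proof. by rewrite (eq_bigl (pred1 (val w))) ?big_pred1_eq // => v; exact: merge_inl. Qed.

Lemma sum_merge_inr n : \sum_(v | merged v == inr tt) n v = n x + n y.
Proof.
rewrite (eq_bigl _ _ merge_inr) (bigD1 x) ?eqxx //=; congr (_ + _).
rewrite (eq_bigl (pred1 y)) ?big_pred1_eq // => v /=.
by have [->|_] := eqVneq v x; rewrite /= ?andbT // (negPf xy).
Qed.

(** The other copies of [e], redirected to the sink, all point to the merged vertex, whichever end
    was their head. *)
Definition merge_orientation D : {ffun edge (contract_edge e) -> option (contract_vertex e)} :=
  [ffun f => merge_vertex e (D (val f))].

Lemma merge_ends z : z \in ends e -> merge_vertex e z = Some (inr tt).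
Proof.
have -> : (z \in ends e) = (z == Some x) || (z == Some y) by rewrite endsE !inE.
by case/orP=> /eqP-> /=; congr Some; apply/eqP; rewrite merge_inr eqxx ?orbT.
Qed.

Lemma merge_orientationP D : orientation D -> orientation (merge_orientation D).
Proof.
move=> /forallP oD; apply/forallP => f; rewrite ffunE /= /contract_ends.
case: ifP => [/eqP E|_]; last exact: imset_f.
by rewrite merge_ends -?E // !inE eqxx.
Qed.

(** Heads are kept up to merging; the correction at the merged vertex accounts for [e], which has
    disappeared. *)
Lemma indeg_merge D (w : contract_vertex e) : orientation D ->
  indeg (merge_orientation D) (Some w) + (w == inr tt) =
  \sum_(v | merged v == w) indeg D (Some v).
Proof.
move=> oD; transitivity #|[set f | merge_vertex e (D f) == Some w]|.
  rewrite (cardsD1 e) inE merge_ends ?(forallP oD) // addnC.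
  rewrite (inj_eq Some_inj) eq_sym; congr (_ + _).
  rewrite /indeg -(card_imset _ val_inj); apply: eq_card => f; rewrite !inE.
  apply/imsetP/andP => [[g]|[fe fu]].
    by rewrite inE ffunE => gu ->; split=> //; apply: (valP g).
  by exists (Sub f fe); rewrite ?inE ?ffunE ?SubK.
under [RHS]eq_bigr => v _ do rewrite /indeg -sum1_card big_mkcond /=.
rewrite exchange_big -sum1_card big_mkcond /=; apply: eq_bigr => f _.
rewrite inE; under eq_bigr => v _ do rewrite inE.
case: (D f) => [v0|] /=; last by rewrite big1.
rewrite (inj_eq Some_inj) -/(merged v0) -big_mkcondr /=.
have [E|E] := eqVneq (merged v0) w; last first.
  rewrite big_pred0 // => v; apply/negbTE; rewrite (inj_eq Some_inj).
  by apply: contra E => /andP[vw /eqP->].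
rewrite (eq_bigl (pred1 v0)) ?big_pred1_eq // => v /=.
by rewrite (inj_eq Some_inj) [v0 == v]eq_sym; case: (eqVneq v v0) => [->|]; rewrite ?E ?eqxx ?andbF.
Qed.

(** All copies of [e] are pointed to [x]. Those that pointed to the sink then count at the merged
    vertex, so indegrees off the sink can only grow. *)
Lemma unmerge (D' : {ffun edge (contract_edge e) -> option (contract_vertex e)}) :
  orientation D' -> exists D, [/\ orientation D, D e = Some x &
    forall w, indeg D' (Some w) <= indeg (merge_orientation D) (Some w)].
Proof.
move=> /forallP oD'.
pose pre (f : edge (contract_edge e)) :=
  odflt None [pick u in ends (val f) | merge_vertex e u == D' f].
pose D := [ffun f => if ends f == ends e then Some x
  else if insub f is Some g then pre g else None].
have preP f : ends (val f) != ends e ->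
    pre f \in ends (val f) /\ merge_vertex e (pre f) = D' f.
  move=> fe; rewrite /pre; case: pickP => [u /andP[uf /eqP uE] //|no].
  have := oD' f; rewrite /= /contract_ends (negPf fe) => /imsetP[u uf uE].
  by have := no u; rewrite uf uE eqxx.
have xe : Some x \in ends e by rewrite endsE !inE eqxx.
exists D; split=> [||w].
- apply/forallP => f; rewrite ffunE; case: eqVneq => [->//|fe].
  have ne : f != e by apply: contraNneq fe => ->.
  by rewrite (insubT (fun f => f != e) ne); have [] := preP (Sub f ne) fe.
- by rewrite ffunE eqxx.
apply/subset_leq_card/subsetP => f; rewrite !inE !ffunE => /eqP fw.
have := oD' f; rewrite fw /= /contract_ends; case: eqVneq => [_|fe _].
  by rewrite merge_ends // !inE => /orP[/eqP<-|].
by rewrite valK; have [_ ->] := preP f fe; rewrite fw.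
Qed.

End DeletionContraction.

(** * The bijections behind the identity *)

Section Identity.
Variables (G : sink_graph) (e : edge G) (x y : vertex G).
Hypotheses (xy : x != y) (endsE : ends e = [set Some x; Some y]).
Implicit Types (l : config G) (v : vertex G).

Lemma notin_ends v : (Some v \notin ends e) = (v != x) && (v != y).
Proof. by rewrite endsE !inE !(inj_eq Some_inj) negb_or. Qed.

Definition merge_config l : config (contract_edge e) :=
  [ffun w => \sum_(v | merged e v == w) l v].

Lemma merge_config_total l : \sum_w merge_config l w = \sum_v l v.
Proof.
rewrite [RHS](partition_big (merged e) predT) //=.
by apply: eq_bigr => w _; rewrite ffunE.
Qed.

Definition shift l : config G := [ffun v => l v + (v == x) - (v == y)].

(** The end of each interval with the largest [l x]: no unit can be moved from [y] to [x] any more.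
    The condition [0 < l y] excludes a truncated subtraction in [shift]. *)
Definition extreme : set (config G) :=
  [set l | lacks G l /\ ~ (0 < l y /\ lacks G (shift l))].

Lemma merge_shift l : 0 < l y -> merge_config (shift l) = merge_config l.
Proof.
move=> ly; apply/ffunP => -[w|[]]; rewrite !ffunE.
  rewrite !sum_merge_inl ffunE; suff [/negPf-> /negPf->] : val w != x /\ val w != y.
    by rewrite addn0 subn0.
  by have := valP w; rewrite notin_ends => /andP.
by rewrite !(sum_merge_inr xy endsE) !ffunE !eqxx (negPf xy) eq_sym (negPf xy); lia.
Qed.

Lemma shiftS_realizable l : 0 < l y -> realizable (fun v => (l v).+1 + (v == x) - (v == y)) ->
  lacks G (shift l).
Proof.
move=> ly r; apply: realizable_le r _ => v; rewrite ffunE.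
by have [->|_] := eqVneq v y; lia.
Qed.

Lemma extreme_exists l : lacks G l ->
  exists2 l', extreme l' & merge_config l' = merge_config l.
Proof.
have [k] := ubnP (l y); elim: k l => // k IH l; rewrite ltnS => lek Ll.
have [[ly Ls]|ns] := pselect (0 < l y /\ lacks G (shift l)); last by exists l.
have [|l' tl' E] := IH (shift l) _ Ls; first by rewrite !ffunE eqxx eq_sym (negPf xy); lia.
by exists l'; rewrite // E merge_shift.
Qed.

(** Vectors with the same image share out one sum between [x] and [y]. If [l x < l' x], an exchange
    towards [l'] would shift [l] once more, against its extremality. *)
Lemma extreme_inj : set_inj extreme merge_config.
Proof.
have notlt l l' : extreme l -> extreme l' -> merge_config l = merge_config l' ->
    l' x <= l x.
  case=> Ll tl [Ll' _] /ffunP E; rewrite leqNgt; apply/negP => lt.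
  have := E (inr tt); rewrite !ffunE !(sum_merge_inr xy endsE) => Exy.
  have ly : 0 < l y by lia.
  case: tl; split=> //; apply: shiftS_realizable => //.
  apply: realizable_exchange Ll Ll' xy _ _ => // v vy; rewrite ltnS.
  have [->|vx] := eqVneq v x; first exact: ltnW.
  have nv : Some v \notin ends e by rewrite notin_ends vx.
  by have := E (inl (Sub v nv)); rewrite !ffunE !sum_merge_inl !SubK => ->.
move=> l l' /set_mem tl /set_mem tl' E.
have Ex : l x = l' x by apply/eqP; rewrite eqn_leq !notlt.
apply/ffunP => v; have [->//|vx] := eqVneq v x.
have [->|vy] := eqVneq v y.
  move/ffunP/(_ (inr tt)): E; rewrite !ffunE !(sum_merge_inr xy endsE) Ex.
  exact: addnI.
have nv : Some v \notin ends e by rewrite notin_ends vx.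
by move/ffunP/(_ (inl (Sub v nv))): E; rewrite !ffunE !sum_merge_inl !SubK.
Qed.

(** [x] and [y] together have indegree at least [l x + l y + 2]; the loss of [e] takes one, which
    leaves what the merged vertex needs. *)
Lemma lacks_merge l : lacks G l -> lacks (contract_edge e) (merge_config l).
Proof.
case=> D oD H; exists (merge_orientation e D); first exact: merge_orientationP endsE _ oD.
move=> w; have := indeg_merge endsE w oD; rewrite ffunE.
case: w => [w|[]]; first by rewrite !sum_merge_inl addn0 => ->; apply: H.
rewrite !(sum_merge_inr xy endsE) /=.
by have := H x; have := H y; lia.
Qed.

Lemma lacks_unmerge (m : config (contract_edge e)) : lacks (contract_edge e) m ->
  exists2 l, lacks G l & merge_config l = m.
Proof.
case=> D' oD' H'; have [D0 [oD0 D0e H0]] := unmerge endsE oD'.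
(* The lifted orientation is adjusted so that both [x] and [y] have an incoming edge, as any vector
   of [lacks G] requires. *)
have [D [oD Dx Dy HD]] : exists D, [/\ orientation D, 0 < indeg D (Some x),
    0 < indeg D (Some y) &
    forall w, indeg (merge_orientation e D0) (Some w) + (w == inr tt) =
      \sum_(v | merged e v == w) indeg D (Some v)].
  have Dx : 0 < indeg D0 (Some x) by apply/card_gt0P; exists e; rewrite inE D0e.
  have HD w := indeg_merge endsE w oD0.
  have [Dy|] := ltnP 0 (indeg D0 (Some y)); first by exists D0.
  rewrite leqn0 => /eqP Dy.
  (* Then [x] has indegree at least [m (inr tt) + 2] and can give [e] up to [y]. *)
  have ne : D0 e != Some y by rewrite D0e (inj_eq Some_inj).
  have flip := indeg_flip ne; set D := [ffun _ => _] in flip.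
  have := HD (inr tt); have := H0 (inr tt); have := H' (inr tt).
  rewrite eqxx (sum_merge_inr xy endsE) Dy => /= m1 m2 m3.
  have fx := flip (Some x); have fy := flip (Some y).
  rewrite D0e !eqxx !(inj_eq Some_inj) [y == x]eq_sym (negPf xy) in fx fy.
  exists D; split.
  - apply/forallP => f; rewrite ffunE; case: eqVneq => [->|_]; last exact: (forallP oD0).
    by rewrite endsE !inE eqxx orbT.
  - by lia.
  - by lia.
  case=> [w|[]]; rewrite HD.
    rewrite !sum_merge_inl; have := flip (Some (val w)); rewrite D0e !(inj_eq Some_inj).
    have := valP w; rewrite notin_ends => /andP[/negPf-> /negPf->].
    by rewrite !addn0.
  by rewrite !(sum_merge_inr xy endsE); lia.
(* As much of [m (inr tt)] as [x] can take; the rest fits at [y] because the two indegrees add up to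
   at least [m (inr tt) + 2]. *)
pose a := minn (indeg D (Some x)).-1 (m (inr tt)).
pose l : config G := [ffun v => if v == x then a
  else if v == y then m (inr tt) - a else m (merged e v)].
have lx : l x = a by rewrite ffunE eqxx.
have ly : l y = m (inr tt) - a by rewrite ffunE eq_sym (negPf xy) eqxx.
have lw (w : {v : vertex G | Some v \notin ends e}) : l (val w) = m (inl w).
  have := valP w; rewrite notin_ends => /andP[/negPf wx /negPf wy].
  rewrite ffunE wx wy; congr (m _); apply/eqP; rewrite merge_inl //.
have sxy := HD (inr tt); rewrite (sum_merge_inr xy endsE) eqxx in sxy.
have mr := leq_trans (H' (inr tt)) (H0 (inr tt)).
exists l; last first.
  apply/ffunP => -[w|[]]; rewrite ffunE ?sum_merge_inl //.
  by rewrite (sum_merge_inr xy endsE) lx ly subnKC ?geq_minr.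
exists D => // v; have [->|vx] := eqVneq v x; first by rewrite lx /a; lia.
have [->|vy] := eqVneq v y; first by rewrite ly /a; lia.
have nv : Some v \notin ends e by rewrite notin_ends vx.
have := HD (inl (Sub v nv)); rewrite sum_merge_inl SubK addn0 => <-.
have -> : l v = m (inl (Sub v nv)) by rewrite -lw SubK.
exact: leq_trans (H' _) (H0 _).
Qed.

Lemma extreme_bij : set_bij extreme (lacks (contract_edge e)) merge_config.
Proof.
split=> [l [/lacks_merge]//||m /lacks_unmerge[l Ll <-]]; first exact: extreme_inj.
by have [l' tl' <-] := extreme_exists Ll; exists l'.
Qed.

Definition undelete_config (l : config (delete_edge e)) : config G :=
  [ffun v : vertex G => l v + (v == y)].

(** Restoring [e] with head [y] realises the image, and with head [x] its shift, so the image is not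
    extreme. Conversely, when a vector and its shift are both realised, [e] can be deleted at the
    cost of one unit at [y]. *)
Lemma shift_bij : set_bij (lacks (delete_edge e)) (lacks G `\` extreme)%classic
  undelete_config.
Proof.
have xe : Some x \in ends e by rewrite endsE !inE eqxx.
have ye : Some y \in ends e by rewrite endsE !inE eqxx orbT.
split=> [l Ll|l l' _ _ /ffunP E|l [Ll]].
- split.
    by apply: realizable_le (realizable_undelete ye Ll) _ => v; rewrite ffunE addSn.
  case=> _; apply; split; first by rewrite ffunE eqxx addn1.
  apply: realizable_le (realizable_undelete xe Ll) _ => v; rewrite !ffunE.
  by have [->|_] := eqVneq v y; lia.
- by apply/ffunP => v; have := E v; rewrite !ffunE => /addIn.
move=> nt; have [ly Ls] : 0 < l y /\ lacks G (shift l) by apply: contrapT => ns; case: nt.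
exists ([ffun v : vertex G => l v - (v == y)] : config (delete_edge e)); last first.
  by apply/ffunP => v; rewrite !ffunE; have [->|_] := eqVneq v y; lia.
apply: realizable_le (@realizable_delete_shift G e x y xy endsE _ Ll _ _ _) _ => //.
- by apply: realizable_le Ls _ => v; rewrite !ffunE; have [->|_] := eqVneq v y; lia.
- by move=> v; rewrite ffunE; have [->|_] := eqVneq v y; lia.
Qed.

End Identity.

Lemma contract_connected (G : sink_graph) (e : edge G) : None \notin ends e ->
  graph_connected G -> graph_connected (contract_edge e).
Proof.
move=> ne conn; have /eqP/cards2P[u [v [uv endsE]]] := card_ends e.
case: u v => [x|] [y|] // in uv endsE *; try by rewrite endsE !inE ?eqxx ?orbT in ne.
rewrite (inj_eq Some_inj) in uv.
have step a b : Defs.adjacent (G := G) a b ->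
    connect (Defs.adjacent (G := contract_edge e)) (merge_vertex e a) (merge_vertex e b).
  case/existsP=> f /eqP fE; have [ef|ef] := eqVneq (ends f) (ends e).
    by rewrite !(merge_ends endsE) ?connect0 // -ef fE !inE eqxx ?orbT.
  have fe : f != e by apply: contraNneq ef => ->.
  apply/connect1/existsP; exists (Sub f fe).
  by rewrite /= /contract_ends SubK (negPf ef) fE imsetU1 imset_set1.
have conn' a b :
    connect (Defs.adjacent (G := contract_edge e)) (merge_vertex e a) (merge_vertex e b).
  have /connectP[p pP ->] := forallP (forallP conn a) b.
  elim: p a pP => [|c p IH] a //= /andP[/step ac /IH]; exact: connect_trans.
have onto w : exists a, w = merge_vertex e a.
  case: w => [[w|[]]|]; last by exists None.
    by exists (Some (val w)) => /=; congr Some; apply/esym/eqP; rewrite merge_inl.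
  by exists (Some x); rewrite (merge_ends endsE) // endsE !inE eqxx.
by apply/forallP => w; apply/forallP => w'; have [a ->] := onto w; have [b ->] := onto w'.
Qed.

Local Open Scope ring_scope.

Theorem theorem3p9 (R : realType) (G : sink_graph) (e : edge G)
    (MG : sandpile R G)
    (MD : sandpile R (delete_edge e))
    (MC : sandpile R (contract_edge e))
    (connG : graph_connected G)
    (nbridge_e : ~~ bridge e)
    (nsink_e : None \notin ends e) :
  lacking_poly MG = 'X * lacking_poly MD + lacking_poly MC.
Proof.
have /eqP/cards2P[u [v [uv endsE]]] := card_ends e.
case: u v => [x|] [y|] // in uv endsE *; try by rewrite endsE !inE ?eqxx ?orbT in nsink_e.
have xy : x != y by rewrite (inj_eq Some_inj) in uv.
rewrite (lacking_polyE MG connG) (lacking_polyE MD (negbNE nbridge_e)).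
rewrite (lacking_polyE MC (contract_connected nsink_e connG)).
(* Extreme vectors match those of the contraction, with the same total; the others match those of
   the deletion. *)
rewrite (fsbigID (extreme x y) _ _ (@finite_lacks G)) [RHS]addrC; congr (_ + _)%R; last first.
  rewrite -classical_sets.setDE (reindex_fsbig _ _ _ _ (shift_bij xy endsE)) mulr_fsumr.
  (* The factor ['X] is the unit that [undelete_config] adds at [y]. *)
  apply: eq_fsbigr => l _; rewrite -exprS; congr ('X^_)%R.
  under eq_bigr => v _ do rewrite ffunE.
  rewrite big_split /= -addn1; congr (_ + _).
  by rewrite (bigD1 y) //= eqxx big1 // => v /negPf->.
rewrite (reindex_fsbig _ _ _ _ (extreme_bij xy endsE)).
rewrite (_ : (lacks G `&` extreme x y)%classic = extreme x y).
  by apply: eq_fsbigr => l _; rewrite merge_config_total.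
by rewrite classical_sets.setIC; apply/classical_sets.setIidPl => l [].
Qed.
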